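(* Let $p$ be a prime of the form $p=4k+1$. If there exist positive integers $d,u,v$ such that $(du,dv,duv)$ is a solution for $p$, i.e. $\frac{4}{p}=\frac{1}{du}+\frac{1}{dv}+\frac{1}{duv}$, then this solution is of Type II.
   Context: For a positive integer $a$, a solution for $a$ is a triple of positive integers $(x,y,z)$ with $\frac{4}{a}=\frac1x+\frac1y+\frac1z$. A solution is of Type II if, after arranging its entries in nondecreasing order $x\le y\le z$, one has $\gcd(a,x)=1$ and $\gcd(a,y)=\gcd(a,z)=a$ (i.e. $a\mid y$ and $a\mid z$). *)

(* Defs.v *)
From mathcomp Require Import all_boot all_order all_algebra.

Set Implicit Arguments.
Unset Strict Implicit.
Unset Printing Implicit Defensive.

Import Order.TTheory GRing.Theory Num.Theory.

Definition is_solution (a : nat) (t : nat * nat * nat) : Prop :=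
  let: (x, y, z) := t in
  [/\ (0 < x)%N, (0 < y)%N, (0 < z)%N
    & (4%:R / a%:R = x%:R^-1 + y%:R^-1 + z%:R^-1 :> rat)%R].

Definition is_typeII (a : nat) (t : nat * nat * nat) : Prop :=
  let: (x, y, z) := t in
  let s := sort leq [:: x; y; z] in
  [/\ is_solution a t,
      gcdn a (nth 0 s 0) = 1,
      gcdn a (nth 0 s 1) = a
    & gcdn a (nth 0 s 2) = a].

(* Main.v *)
Require Import Defs.
From mathcomp Require Import all_boot all_order all_algebra.
From mathcomp Require Import zify.
Import Order.TTheory GRing.Theory Num.Theory.

(** By symmetry let [u <= v], so that [d * u] is the smallest denominator. It is
    at most three quarters of [p], hence coprime to [p]. On the other hand
    [4 * (d * u) * v = p * (u + v + 1)], so [p] must divide [v], which is a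
    factor of both [d * v] and [d * u * v]. *)

Lemma eqr_natdiv_sum3_inv (F : numFieldType) (n a x y z : nat) :
  0 < n -> 0 < x -> 0 < y -> 0 < z ->
  (n%:R / a%:R == x%:R^-1 + y%:R^-1 + z%:R^-1 :> F)%R
  = (n * (x * y * z) == a * (x * y + x * z + y * z)).
Proof.
move=> n_gt0 x_gt0 y_gt0 z_gt0.
have [->|a_gt0] := posnP a.
  have sum_gt0 : (0 < x%:R^-1 + y%:R^-1 + z%:R^-1 :> F)%R.
    by rewrite !addr_gt0 // invr_gt0 ltr0n.
  rewrite invr0 mulr0 (lt_eqF sum_gt0) mul0n gtn_eqF //.
  by rewrite !muln_gt0 n_gt0 x_gt0 y_gt0.
have natr_neq0 (m : nat) : 0 < m -> (m%:R != 0 :> F)%R.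
  by rewrite pnatr_eq0 lt0n.
rewrite -[x%:R^-1%R]div1r -[y%:R^-1%R]div1r -[z%:R^-1%R]div1r.
rewrite !addf_div ?eqr_div ?mulf_neq0 ?natr_neq0 // !mul1r.
rewrite -!(natrM, natrD) eqr_nat.
by congr (_ == _); lia.
Qed.

Lemma is_solutionP {a x y z : nat} :
  is_solution a (x, y, z) <->
  [/\ 0 < x, 0 < y, 0 < z & 4 * (x * y * z) = a * (x * y + x * z + y * z)].
Proof.
split=> -[x_gt0 y_gt0 z_gt0 /eqP sum_eq]; split=> //; apply/eqP.
  by rewrite -(eqr_natdiv_sum3_inv rat).
by rewrite eqr_natdiv_sum3_inv.
Qed.

Lemma is_solution_swap {a x y z : nat} :
  is_solution a (x, y, z) -> is_solution a (y, x, z).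
Proof. by move=> /is_solutionP[*]; apply/is_solutionP; split=> //; lia. Qed.

Lemma is_solution_min_le {a x y z : nat} :
  is_solution a (x, y, z) -> x <= y -> x <= z -> 4 * x <= 3 * a.
Proof.
move=> /is_solutionP[x_gt0 y_gt0 z_gt0 cleared] le_xy le_xz.
have yz_gt0 : 0 < y * z by rewrite muln_gt0 y_gt0.
have le_xy_zy : x * y <= z * y by rewrite leq_mul2r le_xz orbT.
have le_xz_yz : x * z <= y * z by rewrite leq_mul2r le_xy orbT.
rewrite -(leq_pmul2r yz_gt0) -!mulnA (mulnA x) cleared mulnCA leq_mul2l.
by apply/orP; right; lia.
Qed.

Lemma prime_coprime_is_solution_min {p x y z : nat} : prime p ->
  is_solution p (x, y, z) -> x <= y -> x <= z -> coprime p x.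
Proof.
move=> p_prime sol le_xy le_xz; have [x_gt0 _ _ _] := sol.
have le_4x_3p := is_solution_min_le sol le_xy le_xz.
by rewrite prime_coprime // gtnNdvd //; lia.
Qed.

Lemma is_solution_common_factor {a d u v : nat} :
  is_solution a (d * u, d * v, d * u * v) -> 4 * (d * u) * v = a * (u + v + 1).
Proof.
case/is_solutionP=> _ _ duv_gt0 cleared.
have dduv_gt0 : 0 < d * (d * u * v) by rewrite muln_gt0; lia.
by apply/eqP; rewrite -(eqn_pmul2r dduv_gt0); apply/eqP; lia.
Qed.

Lemma is_typeII_swap {a x y z : nat} :
  is_typeII a (x, y, z) -> is_typeII a (y, x, z).
Proof.
rewrite /is_typeII.
have -> : sort leq [:: y; x; z] = sort leq [:: x; y; z].
  apply/perm_sortP; [exact: leq_total|exact: leq_trans|exact: anti_leq|].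
  by rewrite (perm_catCA [:: y] [:: x] [:: z]).
by case=> sol *; split=> //; apply: is_solution_swap.
Qed.

Lemma is_typeII_sorted {a x y z : nat} : x <= y -> y <= z ->
  is_typeII a (x, y, z) <->
  [/\ is_solution a (x, y, z), coprime a x, a %| y & a %| z].
Proof.
move=> le_xy le_yz.
have xyz_sorted : sorted leq [:: x; y; z] by rewrite /= le_xy le_yz.
rewrite /is_typeII (sorted_sort leq_trans xyz_sorted) /=.
by split=> -[sol /eqP ax /gcdn_idPl ay /gcdn_idPl az].
Qed.

Lemma is_typeII_common_factor {p d u v : nat} :
  prime p -> odd p -> u <= v ->
  is_solution p (d * u, d * v, d * u * v) ->
  is_typeII p (d * u, d * v, d * u * v).
Proof.
move=> p_prime p_odd le_uv sol.
have [du_gt0 _ _ _] := sol.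
have le_du_dv : d * u <= d * v by rewrite leq_mul2l le_uv orbT.
have le_dv_duv : d * v <= d * u * v by rewrite mulnAC leq_pmulr //; lia.
have p_du : coprime p (d * u).
  apply: (prime_coprime_is_solution_min p_prime sol le_du_dv).
  exact: leq_trans le_dv_duv.
have p_4 : coprime p 4 by apply: (@coprimeXr 2 p 2); rewrite coprimen2.
have p_v : p %| v.
  have p_4du : coprime p (4 * (d * u)) by rewrite coprimeMr p_4.
  by rewrite -(Gauss_dvdr v p_4du) (is_solution_common_factor sol) dvdn_mulr.
by apply/(is_typeII_sorted le_du_dv le_dv_duv); split; rewrite ?dvdn_mull.
Qed.

Theorem theorem2 (p k : nat) (p_prime : prime p) (pE : p = 4 * k + 1)
  (d u v : nat) (d_gt0 : 0 < d) (u_gt0 : 0 < u) (v_gt0 : 0 < v) :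
  is_solution p (d * u, d * v, d * u * v) ->
  is_typeII p (d * u, d * v, d * u * v).
Proof.
have p_odd : odd p by rewrite pE; lia.
have [le_uv|/ltnW le_vu] := leqP u v; first exact: is_typeII_common_factor.
rewrite mulnAC => /is_solution_swap sol.
exact/is_typeII_swap/is_typeII_common_factor.
Qed.
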